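(* Let $\mathcal{R}M=D\mathcal{C}$ be any U-match decomposition of $D\in\mathbb{K}^{m\times n}$. 1. For each $p\in\{0,\dots,m\}$, the intersection $\mathrm{Cols}(\mathcal{C})\cap D^\bullet G_p$ is a basis for $D^\bullet G_p$. 2. For each $p\in\{0,\dots,n\}$, the intersection $\mathrm{Cols}(\mathcal{R})\cap D_\bullet F_p$ is a basis for $D_\bullet F_p$.
   Context: $\mathbb{K}$ is a field. A (generalized) matching matrix has at most one nonzero entry in each row and each column. A U-match decomposition of $D\in\mathbb{K}^{m\times n}$ is a tuple $(\mathcal{R},M,D,\mathcal{C})$ with $\mathcal{R}M=D\mathcal{C}$, where $M\in\mathbb{K}^{m\times n}$ is a matching matrix and $\mathcal{R}\in\mathbb{K}^{m\times m}$, $\mathcal{C}\in\mathbb{K}^{n\times n}$ are upper unitriangular (upper triangular with ones on the diagonal). $\mathrm{Cols}(B)$ is the set of columns of $B$. $F_p\subseteq\mathbb{K}^n$ is the subspace of vectors supported on $\{1,\dots,p\}$, and $G_p\subseteq\mathbb{K}^m$ is the subspace of vectors supported on $\{1,\dots,p\}$. $D_\bullet F_p=\{Dv: v\in F_p\}$ and $D^\bullet G_p=\{v\in\mathbb{K}^n: Dv\in G_p\}$. *)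

(* Defs.v *)
From HB Require Import structures.
From mathcomp Require Import all_boot all_order all_algebra.
Set Implicit Arguments.
Unset Strict Implicit.
Unset Printing Implicit Defensive.
Import GRing.Theory.
Local Open Scope ring_scope.

Section UMatch.
Variable K : fieldType.

Definition matching_mx m n (M : 'M[K]_(m, n)) : bool :=
  [forall i, #|[set j | M i j != 0%R]| <= 1]%N &&
  [forall j, #|[set i | M i j != 0%R]| <= 1]%N.

(* [is_trig_mx] means lower triangular, hence the transpose. *)
Definition upper_unitriangular n (A : 'M[K]_n) : bool :=
  is_trig_mx A^T && [forall i, A i i == 1].

Definition U_match m n (R : 'M[K]_m) (M D : 'M[K]_(m, n)) (C : 'M[K]_n) : Prop :=
  [/\ matching_mx M, upper_unitriangular R, upper_unitriangular C
    & R *m M = D *m C].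

(* The set of columns as a duplicate-free sequence, since [basis_of] takes a
   sequence. *)
Definition Cols m n (B : 'M[K]_(m, n)) : seq 'cV[K]_m :=
  undup [seq col j B | j : 'I_n].

(* The vectors supported on {1, ..., p}: every coordinate of 0-based index
   i >= p vanishes. This is F_p for k = n and G_p for k = m. *)
Definition supp_vs k (p : nat) : {vspace 'cV[K]_k} :=
  (\bigcap_(i < k | (p <= i)%N) lker (linfun (fun v : 'cV[K]_k => v i 0%R : K^o)))%VS.

Definition img_vs m n (D : 'M[K]_(m, n)) (p : nat) : {vspace 'cV[K]_m} :=
  (linfun (mulmx D : 'cV[K]_n -> 'cV[K]_m) @: supp_vs n p)%VS.

Definition preim_vs m n (D : 'M[K]_(m, n)) (p : nat) : {vspace 'cV[K]_n} :=
  (linfun (mulmx D : 'cV[K]_n -> 'cV[K]_m) @^-1: supp_vs m p)%VS.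

Lemma supp_vsP k p (v : 'cV[K]_k) :
  reflect (forall i : 'I_k, v i 0 != 0 -> (i < p)%N) (v \in supp_vs k p).
Proof.
have lin i : linear (fun v : 'cV[K]_k => v i 0 : K^o) by move=> a x y; rewrite !mxE.
have kerE i : (v \in lker (linfun (fun v : 'cV[K]_k => v i 0 : K^o))) = (v i 0 == 0).
  pose H := GRing.isLinear.Build _ _ _ _ _ (lin i).
  pose f : {linear 'cV[K]_k -> K^o} := HB.pack (fun v : 'cV[K]_k => v i 0 : K^o) H.
  by rewrite memv_ker (lfunE f).
rewrite memvE; apply: (iffP subv_bigcapP) => h i.
  by apply: contraR; rewrite -leqNgt => /h; rewrite -memvE kerE.
by rewrite -memvE kerE leqNgt; apply: contraR => /h.
Qed.

Lemma img_vsP m n (D : 'M[K]_(m, n)) p (w : 'cV[K]_m) :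
  reflect (exists2 v, v \in supp_vs n p & w = D *m v) (w \in img_vs D p).
Proof. by apply: (iffP memv_imgP) => -[v vF ->]; exists v; rewrite ?lfunE. Qed.

Lemma preim_vsE m n (D : 'M[K]_(m, n)) p (v : 'cV[K]_n) :
  (v \in preim_vs D p) = (D *m v \in supp_vs m p).
Proof. by rewrite -memv_preim lfunE. Qed.

End UMatch.

(* Main.v *)
(* Since [R] and [C] preserve supports in both directions, everything reduces to
   the matching matrix [M]: if [x j != 0] and [M i j != 0] then
   [(M x) i = M i j * x j], and the j-th column of [M] is a multiple of the i-th
   basis vector. Hence both spaces are closed under passing from a vector to the
   columns of [C] (resp. [R]) which occur in its expansion. *)
Require Import Defs.
From mathcomp Require Import all_boot all_order all_algebra.
Set Implicit Arguments.
Unset Strict Implicit.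
Unset Printing Implicit Defensive.
Import GRing.Theory.
Local Open Scope ring_scope.

(** The columns of an invertible [A] form a basis of the whole space, so those lying in [U] are
    free. They span [U] because the second hypothesis puts into [U] every column that occurs in the
    expansion of a vector of [U]. *)
Lemma basis_of_Cols (K : fieldType) n (A : 'M[K]_n) (U : {vspace 'cV[K]_n}) :
  A \in unitmx ->
  (forall (x : 'cV[K]_n) j, A *m x \in U -> x j 0 != 0 -> col j A \in U) ->
  basis_of U [seq v <- Cols A | v \in U].
Proof.
move=> uA coordU.
have mulAE (x : 'cV[K]_n) : A *m x = \sum_j x j 0 *: col j A.
  apply/colP=> i; rewrite !mxE summxE; apply: eq_bigr => j _.
  by rewrite !mxE mulrC.
have memC j : col j A \in Cols A by rewrite mem_undup image_f.
have freeC : free (Cols A).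
  have fullC : <<Cols A>>%VS = fullv.
    apply/eqP; rewrite eqEsubv subvf; apply/subvP=> v _.
    rewrite -[v](mulKVmx uA) mulAE memv_suml // => j _.
    by rewrite memvZ // memv_span.
  (* Freeness by counting: a list of at most [n] vectors that spans a space of dimension [n] is
     free. As [undup] can only shorten the list, distinctness of the columns need not be shown. *)
  rewrite /free eqn_leq dim_span fullC dimvf /dim /= muln1.
  by rewrite (leq_trans (size_undup _)) // size_image card_ord.
rewrite /basis_of filter_free // andbT eqEsubv; apply/andP; split.
  by apply/span_subvP=> v; rewrite mem_filter => /andP[].
apply/subvP=> v; rewrite -[v](mulKVmx uA); set x := _ *m v => Ux.
rewrite mulAE memv_suml // => j _.
have [->|xj0] := eqVneq (x j 0) 0; first by rewrite scale0r mem0v.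
by rewrite memvZ // memv_span // mem_filter memC (coordU x).
Qed.

Section Unitriangular.

Variables (K : fieldType) (n : nat) (A : 'M[K]_n).
Hypothesis uniA : upper_unitriangular A.

Lemma upper_unitriangular_diag i : A i i = 1.
Proof. by case/andP: uniA => _ /forallP/(_ i)/eqP. Qed.

Lemma upper_unitriangular_eq0 (i j : 'I_n) : (j < i)%N -> A i j = 0.
Proof.
by case/andP: uniA => /is_trig_mxP trigA _ /trigA; rewrite mxE.
Qed.

Lemma upper_unitriangular_unitmx : A \in unitmx.
Proof.
case/andP: uniA => trigA _; rewrite -unitmx_tr unitmxE det_trig //.
by rewrite big1 ?unitr1 // => i _; rewrite mxE upper_unitriangular_diag.
Qed.

(** Triangularity keeps the support of [A *m v] within the initial segment; the ones on the diagonal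
    give the converse, since the last nonzero coordinate of [v] cannot be cancelled. *)
Lemma mulmx_supp_vs p (v : 'cV[K]_n) :
  (A *m v \in supp_vs K n p) = (v \in supp_vs K n p).
Proof.
apply/supp_vsP/supp_vsP => suppv i; last first.
  rewrite mxE; apply: contraR; rewrite -leqNgt => le_pi.
  apply/eqP/big1 => j _.
  have [/upper_unitriangular_eq0->|le_ij] := ltnP j i; first by rewrite mul0r.
  have [->|/suppv] := eqVneq (v j 0) 0; first by rewrite mulr0.
  by rewrite ltnNge (leq_trans le_pi).
(* At the last nonzero coordinate [k] of [v], [A v] and [v] agree. *)
move=> vi0; case: (@arg_maxnP _ i (fun k => v k 0 != 0) val vi0) => /= k vk0 maxk.
apply: leq_ltn_trans (maxk i vi0) (suppv k _).
rewrite mxE (bigD1 k) //= upper_unitriangular_diag mul1r big1 ?addr0 // => j.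
rewrite neq_ltn => /orP[/upper_unitriangular_eq0->|]; first by rewrite mul0r.
rewrite ltnNge; have [->|/maxk->//] := eqVneq (v j 0) 0.
by rewrite mulr0.
Qed.

End Unitriangular.

Lemma delta_supp_vs (K : fieldType) n (j : 'I_n) p :
  (j < p)%N -> (delta_mx j 0 : 'cV[K]_n) \in supp_vs K n p.
Proof.
move=> lt_jp; apply/supp_vsP => i; rewrite mxE.
by case: (eqVneq i j) => [->|] //=; rewrite eqxx.
Qed.

Section Matching.

Variables (K : fieldType) (m n : nat) (M : 'M[K]_(m, n)).
Hypothesis matchM : matching_mx M.

Lemma matching_mx_row i j j' : M i j != 0 -> j' != j -> M i j' = 0.
Proof.
case/andP: matchM => /forallP/(_ i)/card_le1_eqP le1 _ Mij.
by apply: contraNeq => Mij'; apply/eqP/le1; rewrite inE.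
Qed.

Lemma matching_mx_col i j i' : M i j != 0 -> i' != i -> M i' j = 0.
Proof.
case/andP: matchM => _ /forallP/(_ j)/card_le1_eqP le1 Mij.
by apply: contraNeq => Mi'j; apply/eqP/le1; rewrite inE.
Qed.

Lemma matching_mulmx i j (x : 'cV[K]_n) :
  M i j != 0 -> (M *m x) i 0 = M i j * x j 0.
Proof.
move=> Mij; rewrite mxE (bigD1 j) //= big1 ?addr0 // => j' /(matching_mx_row Mij)->.
by rewrite mul0r.
Qed.

Lemma matching_col i j : M i j != 0 -> col j M = M i j *: delta_mx i 0.
Proof.
move=> Mij; apply/colP=> i'; rewrite !mxE andbT.
case: (eqVneq i' i) => [->|/(matching_mx_col Mij)->]; first by rewrite mulr1.
by rewrite mulr0.
Qed.

End Matching.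

Theorem mainTheorem6 (K : fieldType) (m n : nat)
    (R : 'M[K]_m) (M D : 'M[K]_(m, n)) (C : 'M[K]_n) :
  U_match R M D C ->
  (forall p : nat, (p <= m)%N ->
     basis_of (preim_vs D p) [seq v <- Cols C | v \in preim_vs D p]) /\
  (forall p : nat, (p <= n)%N ->
     basis_of (img_vs D p) [seq v <- Cols R | v \in img_vs D p]).
Proof.
case=> matchM uniR uniC RM_DC.
have uR := upper_unitriangular_unitmx uniR.
have uC := upper_unitriangular_unitmx uniC.
split=> p _; apply: basis_of_Cols => // x j.
(* As [D *m (C *m x) = R *m (M *m x)], membership of [C *m x] only depends on the support of
   [M *m x]. *)
- rewrite !preim_vsE mulmxA -RM_DC -mulmxA mulmx_supp_vs // => /supp_vsP suppMx xj0.
  rewrite colE mulmxA -RM_DC -mulmxA mulmx_supp_vs // -colE.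
  apply/supp_vsP=> i; rewrite mxE => Mij; apply: suppMx.
  by rewrite (matching_mulmx matchM _ Mij) mulf_neq0.
- case/img_vsP=> v suppv Rx_Dv xj0.
  (* In the coordinates [y] of [v] with respect to [C], the equation [R *m x = D *m v] becomes
     [x = M *m y]. *)
  pose y := invmx C *m v.
  have Cy : C *m y = v by rewrite mulKVmx.
  have suppy : y \in supp_vs K n p by rewrite -(mulmx_supp_vs uniC) Cy.
  have xE : x = M *m y.
    by rewrite -[x](mulKmx uR) Rx_Dv -Cy mulmxA -RM_DC -mulmxA mulKmx.
  have /existsP[k /andP[Mjk yk0]] : [exists k, (M j k != 0) && (y k 0 != 0)].
    apply: contraNT xj0; rewrite negb_exists => /forallP allk.
    rewrite xE mxE big1 // => k _; apply/eqP; rewrite mulf_eq0.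
    by have := allk k; rewrite negb_and !negbK.
  (* [D] sends column [k] of [C] to [R *m col k M], which is [M j k] times column [j] of [R]; hence
     the scaling. Since [y k 0 != 0], the index [k] is below [p]. *)
  apply/img_vsP; exists ((M j k)^-1 *: (C *m delta_mx k 0)).
    by rewrite memvZ // mulmx_supp_vs // delta_supp_vs //; apply: (supp_vsP _ _ suppy).
  rewrite -scalemxAr mulmxA -RM_DC -mulmxA -colE (matching_col matchM Mjk).
  by rewrite -scalemxAr scalerA mulVf // scale1r colE.
Qed.
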